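(* For almost every $\boldsymbol x\in\Omega_p$, define the extended integrand $W_{\boldsymbol x}:\mathbb R^{d\times d}\to\mathbb R\cup\{+\infty\}$ by $$W_{\boldsymbol x}(\boldsymbol P):=\begin{cases} G\bigl(\boldsymbol P\boldsymbol M^{-1}\boldsymbol P^T,\ \det(\boldsymbol P\boldsymbol M^{-1}\boldsymbol P^T),\ \boldsymbol M\bigr), & \det\boldsymbol P>0,\\ +\infty, & \det\boldsymbol P\le 0,\end{cases}$$ where $\boldsymbol M=\boldsymbol M(\boldsymbol x)$. Then $W_{\boldsymbol x}$ is polyconvex as a function of $\boldsymbol P$ (where $\boldsymbol P$ stands for the inverse Jacobian $\boldsymbol J^{-1}$).
   Context: Let $d\ge2$ and let $\Omega_p\subset\mathbb R^d$ be a bounded polygonal or polyhedral domain, $\Omega_c\subset\mathbb R^d$ the computational domain (with finite positive measure $|\Omega_c|$). $\boldsymbol M=\boldsymbol M(\boldsymbol x)$ is a symmetric positive-definite matrix field on $\Omega_p$ with $m_0\boldsymbol I\le\boldsymbol M(\boldsymbol x)\le m_1\boldsymbol I$ for a.e. $\boldsymbol x\in\Omega_p$, where $m_0,m_1>0$ are constants. Set $\rho(\boldsymbol x)=\sqrt{\det\boldsymbol M(\boldsymbol x)}$, $\sigma=\int_{\Omega_p}\rho\,d\boldsymbol x$, $\theta=(\sigma/|\Omega_c|)^{-2/d}$, $\gamma>1$, $p=d\gamma/2$, $\kappa_\theta=p\,d^{p-1}\theta^p$. The density is $$G(\boldsymbol A,a,\boldsymbol M)=\rho\,\bigl([\operatorname{tr}(\boldsymbol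 A)]^p-\kappa_\theta\log a\bigr),\qquad \boldsymbol A \text{ symmetric positive definite},\ a>0 .$$ A function $W:\mathbb R^{d\times d}\to\mathbb R\cup\{+\infty\}$ is polyconvex if there is a convex function $H$ with values in $\mathbb R\cup\{+\infty\}$ on the space of all minors such that $W(\boldsymbol P)=H(\boldsymbol P,\mathcal M_2(\boldsymbol P),\ldots,\mathcal M_{d-1}(\boldsymbol P),\det\boldsymbol P)$ for every $\boldsymbol P\in\mathbb R^{d\times d}$, where $\mathcal M_k(\boldsymbol P)$ is the vector of all $k\times k$ minors of $\boldsymbol P$. *)

(* Defs.v *)
From HB Require Import structures.
From mathcomp Require Import all_boot all_order all_algebra.
From mathcomp Require Import all_classical all_reals all_analysis.

Set Implicit Arguments.
Unset Strict Implicit.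
Unset Printing Implicit Defensive.

Import Order.TTheory GRing.Theory Num.Theory.
Import numFieldNormedType.Exports.

Local Open Scope classical_set_scope.
Local Open Scope ring_scope.

(* The Borel sigma-algebra of a space of matrices, generated by the entries;
   R^d is 'rV[R]_d. *)

Definition mx_display : measure_display.
Proof. exact: default_measure_display. Qed.

Section measurable_matrix.
Context {R : realType} (m n : nat).

Definition mx_measurable : set (set 'M[R]_(m, n)) :=
  <<s [set A | exists i j, exists2 B : set R,
                 measurable B & A = (fun X : 'M[R]_(m, n) => X i j) @^-1` B] >>.

Let mx_measurable0 : mx_measurable set0.
Proof. exact: sigma_algebra0. Qed.

Let mx_measurableC A : mx_measurable A -> mx_measurable (~` A).
Proof. exact: sigma_algebraC. Qed.

Let mx_measurable_bigcup (F : _^nat) :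
  (forall i, mx_measurable (F i)) -> mx_measurable (\bigcup_i F i).
Proof. exact: sigma_algebra_bigcup. Qed.

HB.instance Definition _ := @isMeasurable.Build mx_display 'M[R]_(m, n)
  mx_measurable mx_measurable0 mx_measurableC mx_measurable_bigcup.

End measurable_matrix.

Lemma measurable_mx_entry (R : realType) (m n : nat) (i : 'I_m) (j : 'I_n) :
  measurable_fun setT (fun X : 'M[R]_(m, n) => X i j).
Proof.
move=> _ B mB; rewrite setTI; apply: sub_sigma_algebra.
by exists i, j, B.
Qed.

Lemma measurable_fun_mx d (T : measurableType d) (R : realType) (m n : nat)
    (f : T -> 'M[R]_(m, n)) :
  (forall i j, measurable_fun setT (fun x => f x i j)) ->
  measurable_fun setT f.
Proof.
move=> mf; apply: (@measurability _ _ _ _ _ _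
  [set A | exists i j, exists2 B : set R,
     measurable B & A = (fun X : 'M[R]_(m, n) => X i j) @^-1` B]) => //.
move=> _ [_ [i [j [B mB ->]]] <-].
by apply: mf.
Qed.

(* Lebesgue measure on R^n: the n-fold product of Lebesgue measure on R, carried
   along the bijection R * R^n -> R^(n+1). *)

Section rV_cons.
Context {R : realType} (n : nat).

Definition rV_cons (p : measurableTypeR R * 'rV[R]_n) : 'rV[R]_n.+1 :=
  \row_i (if unlift ord0 i is Some j then p.2 0 j else p.1).

Definition rV_uncons (v : 'rV[R]_n.+1) : measurableTypeR R * 'rV[R]_n :=
  (v 0 0, \row_j v 0 (lift ord0 j)).

Lemma rV_uncons_cons : cancel rV_uncons rV_cons.
Proof.
by move=> v; apply/rowP => i; rewrite mxE /=; case: unliftP => [j ->|->];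
  rewrite ?mxE.
Qed.

Lemma rV_cons_uncons : cancel rV_cons rV_uncons.
Proof.
move=> [a v]; rewrite [LHS]surjective_pairing; congr (_, _); first by rewrite /= mxE unlift_none.
by apply/rowP => j; rewrite !mxE liftK.
Qed.

Lemma measurable_rV_cons : measurable_fun setT rV_cons.
Proof.
apply: measurable_fun_mx => i j; case: (unliftP ord0 j) => [k ->|->].
  apply: (eq_measurable_fun (fun p : measurableTypeR R * 'rV[R]_n => p.2 0 k)).
    by move=> p _; rewrite mxE liftK.
  by apply: (measurableT_comp (measurable_mx_entry 0 k)); exact: measurable_snd.
apply: (eq_measurable_fun (fun p : measurableTypeR R * 'rV[R]_n => p.1)).
  by move=> p _; rewrite mxE unlift_none.
exact: measurable_fst.
Qed.

Lemma measurable_rV_uncons : measurable_fun setT rV_uncons.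
Proof.
apply/measurable_fun_pairP; split; first exact: measurable_mx_entry.
apply: measurable_fun_mx => i j.
apply: (eq_measurable_fun (fun v : 'rV[R]_n.+1 => v 0 (lift ord0 j))).
  by move=> v _; rewrite /= mxE.
exact: measurable_mx_entry.
Qed.

Variable mu : {sigma_finite_measure set 'rV[R]_n -> \bar R}.

Definition lebesgue_cons : set 'rV[R]_n.+1 -> \bar R :=
  pushforward (@lebesgue_measure R \x mu)%E rV_cons.

Let lebesgue_cons0 : lebesgue_cons set0 = 0%E.
Proof. by rewrite /lebesgue_cons /pushforward preimage_set0 measure0. Qed.

Let lebesgue_cons_ge0 A : (0 <= lebesgue_cons A)%E.
Proof. by rewrite /lebesgue_cons /pushforward measure_ge0. Qed.

Let lebesgue_cons_sigma_additive : semi_sigma_additive lebesgue_cons.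
Proof.
have mpre A : measurable A -> measurable (rV_cons @^-1` A).
  by move=> mA; rewrite -[X in measurable X]setTI; exact: measurable_rV_cons.
move=> F mF tF mUF; rewrite /lebesgue_cons /pushforward preimage_bigcup.
apply: measure_semi_sigma_additive.
- by move=> k; exact: mpre.
- apply/trivIsetP => /= i j _ _ ij; rewrite -preimage_setI.
  by move/trivIsetP : tF => /(_ _ _ _ _ ij) ->//; rewrite preimage_set0.
- by rewrite -preimage_bigcup; exact: mpre.
Qed.

HB.instance Definition _ := isMeasure.Build _ _ _ lebesgue_cons
  lebesgue_cons0 lebesgue_cons_ge0 lebesgue_cons_sigma_additive.

Let lebesgue_cons_sigma_finite : sigma_finite setT lebesgue_cons.
Proof.
have /sigma_finiteP[F [TF ndF Foo]] := sigma_finiteT (@lebesgue_measure R).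
have /sigma_finiteP[G [TG ndG Goo]] := sigma_finiteT mu.
exists (fun k => rV_uncons @^-1` (F k `*` G k)).
  rewrite -preimage_bigcup [X in _ @^-1` X](_ : _ = setT) ?preimage_setT//.
  apply/seteqP; split=> // -[x y] _.
  have [[i _ Fx] [j _ Gy]] : (\bigcup_k F k) x /\ (\bigcup_k G k) y.
    by rewrite -TF -TG.
  exists (maxn i j) => //; split=> /=.
    by move: x Fx; exact/subsetPset/ndF/leq_maxl.
  by move: y Gy; exact/subsetPset/ndG/leq_maxr.
move=> k; have [mF Fkoo] := Foo k; have [mG Gkoo] := Goo k; split.
  rewrite -[X in measurable X]setTI; apply: measurable_rV_uncons => //.
  exact: measurableX.
rewrite /lebesgue_cons /pushforward -comp_preimage.
rewrite (_ : rV_uncons \o rV_cons = id) ?preimage_id//; last first.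
  by apply/funext => p; exact: rV_cons_uncons.
by rewrite product_measure1E// lte_mul_pinfty// ge0_fin_numE.
Qed.

HB.instance Definition _ := Measure_isSigmaFinite.Build _ _ _ lebesgue_cons
  lebesgue_cons_sigma_finite.

End rV_cons.

(* On the one-point space R^0, Lebesgue measure is the unit mass. *)
Section rV0.
Context {R : realType}.

Definition lebesgue_nil : set 'rV[R]_0 -> \bar R := dirac (0 : 'rV[R]_0).

HB.instance Definition _ := Measure.on lebesgue_nil.

Let lebesgue_nil_sigma_finite : sigma_finite setT lebesgue_nil.
Proof.
by exists (fun=> setT); [rewrite bigcup_const|move=> _; split;
  rewrite ?/lebesgue_nil ?diracT ?ltry].
Qed.

HB.instance Definition _ := Measure_isSigmaFinite.Build _ _ _ lebesgue_nil
  lebesgue_nil_sigma_finite.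

End rV0.

Fixpoint lebesgue_rV (R : realType) (n : nat) :
    {sigma_finite_measure set 'rV[R]_n -> \bar R} :=
  if n is n'.+1 then lebesgue_cons (lebesgue_rV R n') else lebesgue_nil.

Lemma measurable_rV_box (R : realType) (n : nat) (A : 'I_n -> set R) :
  (forall i, measurable (A i)) ->
  measurable [set v : 'rV[R]_n | forall i, A i (v 0 i)].
Proof.
move=> mA; rewrite (_ : [set _ | _] =
  \bigcap_i ((fun v : 'rV[R]_n => v 0 i) @^-1` A i)); last first.
  by apply/seteqP; split=> [v vA i _|v vA i]; apply: vA.
apply: fin_bigcap_measurable => [|i _]; first exact: finite_finset.
by rewrite -[X in measurable X]setTI; exact: measurable_mx_entry.
Qed.

Lemma lebesgue_rV_box (R : realType) (n : nat) (A : 'I_n -> set R) :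
  (forall i, measurable (A i)) ->
  lebesgue_rV R n [set v | forall i, A i (v 0 i)] =
  (\prod_(i < n) lebesgue_measure (A i))%E.
Proof.
elim: n A => [|n IHn] A mA.
  by rewrite big_ord0 /= /lebesgue_nil diracE mem_set// => -[].
rewrite big_ord_recl /= /lebesgue_cons /pushforward.
have -> : @rV_cons R n @^-1` [set v | forall i, A i (v 0 i)] =
    A ord0 `*` [set v : 'rV[R]_n | forall i : 'I_n, A (lift ord0 i) (v 0 i)].
  apply/seteqP; split => -[a v] /=.
    move=> h; split=> [|i]; [have := h ord0|have := h (lift ord0 i)].
      by rewrite mxE unlift_none.
    by rewrite mxE liftK.
  move=> [a0 h] i; rewrite mxE; by case: unliftP => [j ->|->].
rewrite product_measure1E; first by rewrite (IHn (fun i => A (lift ord0 i))).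
  exact: mA.
exact: (@measurable_rV_box R n (fun i => A (lift ord0 i))).
Qed.

(* Lebesgue measurability on D: agreement almost everywhere with a Borel map. *)
Definition lebesgue_measurable_fun (R : realType) (d m n : nat)
    (D : set 'rV[R]_d) (f : 'rV[R]_d -> 'M[R]_(m, n)) :=
  exists2 g : 'rV[R]_d -> 'M[R]_(m, n),
    measurable_fun D g & {ae lebesgue_rV R d, forall x, D x -> f x = g x}.

Definition is_domain (R : realType) (d : nat) (Omega : set 'rV[R]_d) :=
  [/\ open Omega, connected Omega & Omega !=set0].

(* The boundary of a bounded polygon or polyhedron lies in finitely many affine
   hyperplanes {x | a . x = b}; slits are allowed. *)
Definition polyhedral_domain (R : realType) (d : nat) (Omega : set 'rV[R]_d) :=
  is_domain Omega /\
  exists2 hs : seq ('rV[R]_d * R), (forall h, h \in hs -> h.1 != 0) &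
    closure Omega `\` interior Omega `<=`
      [set x | exists2 h, h \in hs & (h.1 *m x^T) 0 0 = h.2].

Section matrices.
Context {R : realType} {d : nat}.
Implicit Types A B P M : 'M[R]_d.

Definition loewner_le A B :=
  forall v : 'rV[R]_d, (v *m A *m v^T) 0 0 <= (v *m B *m v^T) 0 0.

Definition spd A :=
  A^T = A /\ forall v : 'rV[R]_d, v != 0 -> 0 < (v *m A *m v^T) 0 0.

(* A k x k minor is selected by the k-element sets I of rows and J of columns. *)
Definition minor (I J : {set 'I_d}) (eqJI : #|J| = #|I|) P : R :=
  \det (\matrix_(a < #|I|, b < #|I|)
          P (enum_val a) (enum_val (cast_ord (esym eqJI) b))).

End matrices.

(* All pairs (I, J) with 2 <= #|I| = #|J| <= d - 1. *)
Definition middle_index (d : nat) : predArgType :=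
  {IJ : {set 'I_d} * {set 'I_d} |
     (2 <= #|IJ.1| <= d - 1)%N && (#|IJ.2| == #|IJ.1|)}.
HB.instance Definition _ (d : nat) := Finite.on (middle_index d).

Lemma middle_index_card (d : nat) (s : middle_index d) :
  #|(val s).2| = #|(val s).1|.
Proof. by have /andP[_ /eqP] := valP s. Qed.

Definition middle_minors (R : realType) (d : nat) (P : 'M[R]_d) :
    {ffun middle_index d -> R^o} :=
  [ffun s => minor (middle_index_card s) P].

(* The coordinates are P itself, its minors of orders 2, ..., d - 1, and its
   determinant. *)
Definition minor_space (R : realType) (d : nat) : lmodType R :=
  ('M[R]_d * {ffun middle_index d -> R^o} * R^o)%type.

(* Since 0 * +oo = 0 in \bar R, the end points t = 0, 1 impose nothing. *)
Definition convex_ereal (R : realType) (E : lmodType R) (H : E -> \bar R) :=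
  forall (x y : E) (t : R), 0 <= t <= 1 ->
    (H (t *: x + (1 - t) *: y)%R <= t%:E * H x + (1 - t)%:E * H y)%E.

Definition polyconvex (R : realType) (d : nat) (W : 'M[R]_d -> \bar R) :=
  exists H : minor_space R d -> \bar R,
    [/\ forall z, H z != -oo%E, convex_ereal H &
        forall P, W P = H (P, middle_minors P, \det P)].

Section energy.
Context {R : realType} (d : nat) (gamma theta : R).

Definition rho (M : 'M[R]_d) : R := Num.sqrt (\det M).

Definition exponent : R := d%:R * gamma / 2.

Definition kappa : R :=
  exponent * d%:R `^ (exponent - 1) * theta `^ exponent.

(* Used only for A symmetric positive definite and a > 0. *)
Definition G (A : 'M[R]_d) (a : R) (M : 'M[R]_d) : R :=
  rho M * ((\tr A) `^ exponent - kappa * ln a).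

Definition W (M P : 'M[R]_d) : \bar R :=
  if 0 < \det P then
    let A := P *m invmx M *m P^T in (G A (\det A) M)%:E
  else +oo%E.

End energy.

(* Main.v *)
Require Import Defs.
From mathcomp Require Import all_boot all_order all_algebra.
From mathcomp Require Import all_classical all_reals all_analysis.
From mathcomp Require Import lra.

Import Order.TTheory GRing.Theory Num.Theory.
Import numFieldNormedType.Exports.

Local Open Scope classical_set_scope.
Local Open Scope ring_scope.

Set Implicit Arguments.
Unset Strict Implicit.
Unset Printing Implicit Defensive.

(** On the set where [\det P] is positive, the density splits because
    [\det (P M^-1 P^T) = (\det P)^2 / \det M]:

      [W P = rho (\tr (P M^-1 P^T) `^ p - kappa (2 ln (\det P) - ln (\det M)))].

    The first term depends on [P] alone and the second on [\det P] alone, so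
    replacing [\det P] by an independent variable [a] gives a candidate function
    of the minors, extended by [+oo] to [a <= 0].  It is convex for three
    reasons.  The trace is a nonnegative quadratic form in [P] since [M^-1] is
    positive semidefinite, hence convex ([psd_trace_convex]), and composing it
    with the nondecreasing convex function [x `^ p] on [x >= 0], where
    [p = d gamma / 2 >= 1], keeps it convex.  The logarithm is concave and [kappa]
    is nonnegative.  The set [a > 0] is convex, so the value [+oo] outside it does
    no harm ([convex_ereal_restrict]). *)

(** * Quadratic forms of positive matrices *)

Section quadratic_forms.
Context {R : realType} {d : nat}.
Implicit Types (A S P Q : 'M[R]_d) (v : 'rV[R]_d) (t : R).

Lemma norm2_gt0 v : v != 0 -> 0 < (v *m v^T) 0 0.
Proof.
move=> /rV0Pn[i vi]; rewrite mxE (bigD1 i)//= mxE -expr2.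
rewrite ltr_pwDl ?exprn_even_gt0//; apply: sumr_ge0 => j _.
by rewrite mxE -expr2 sqr_ge0.
Qed.

(** Join the identity to [A] by a segment.  All its members have a positive
    quadratic form, so none is singular; a determinant that is nonpositive at
    [A] and equal to [1] at the identity would vanish in between. *)
Lemma det_gt0 A : (forall v, v != 0 -> 0 < (v *m A *m v^T) 0 0) -> 0 < \det A.
Proof.
move=> A_gt0; rewrite ltNge; apply/negP => detA_le0.
pose p : {poly R} := \det ('X%:M + (1 - 'X) *: map_mx polyC A).
have pE t : p.[t] = \det (t%:M + (1 - t) *: A).
  rewrite -horner_evalE -det_map_mx; congr (\det _).
  apply/matrixP => i j; rewrite !mxE /= horner_evalE.
  by case: (i == j); rewrite ?mulr1n ?mulr0n !hornerE.
have [||t /andP[t_ge0 t_le1]] := @poly_ivt _ p 0 1; first exact: ler01.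
  rewrite !pE subr0 subrr scale0r scale1r addr0 det1 ler01 andbT.
  by rewrite (_ : 0%:M = 0) ?add0r// -scalemx1 scale0r.
rewrite /root pE => /det0P[v v_neq0 /(congr1 (fun u => (u *m v^T) 0 0))].
rewrite mul0mx [RHS]mxE mulmxDr mulmxDl mul_mx_scalar -scalemxAr -!scalemxAl.
have -> (B C : 'M[R]_1) : (t *: B + (1 - t) *: C) 0 0 =
    t * B 0 0 + (1 - t) * C 0 0.
  by rewrite !mxE.
move=> /eqP; apply/negP; rewrite gt_eqF//.
have := A_gt0 v v_neq0; have := norm2_gt0 v_neq0.
move: ((v *m v^T) 0 0) ((v *m A *m v^T) 0 0) => a b a_gt0 b_gt0.
have [->|t_neq1] := eqVneq t 1; first by rewrite subrr mul0r addr0 mul1r.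
rewrite ltr_wpDl ?mulr_ge0 ?(ltW a_gt0)// mulr_gt0//.
by rewrite subr_gt0 lt_neqAle t_neq1.
Qed.

Lemma spd_unitmx A : spd A -> A \in unitmx.
Proof. by move=> [_ /det_gt0 detA]; rewrite unitmxE unitfE gt_eqF. Qed.

Definition psd S := forall v, 0 <= (v *m S *m v^T) 0 0.

Lemma spd_psd_inv A : spd A -> psd (invmx A).
Proof.
move=> spdA v; have Au := spd_unitmx spdA; have [At A_gt0] := spdA.
(* With w = v A^-1 the form of A^-1 at v is the form of A at w. *)
have -> : v *m invmx A *m v^T = (v *m invmx A) *m A *m (v *m invmx A)^T.
  by rewrite mulmxKV// trmx_mul trmx_inv At mulmxA.
have [->|w0] := eqVneq (v *m invmx A) 0; first by rewrite !mul0mx mxE.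
exact/ltW/A_gt0.
Qed.

(** The trace is the sum of the values of the form [S] at the rows of [P]. *)
Lemma psd_trace_ge0 S P : psd S -> 0 <= \tr (P *m S *m P^T).
Proof.
move=> S_ge0; apply: sumr_ge0 => i _.
have -> : (P *m S *m P^T) i i = (row i P *m S *m (row i P)^T) 0 0.
  rewrite -row_mul [LHS]mxE [RHS]mxE; apply: eq_bigr => k _.
  by congr (_ * _); [rewrite [RHS]mxE|rewrite !mxE].
exact: S_ge0.
Qed.

(** For [q P] the trace of [P S P^T], the gap
    [t q(P) + (1 - t) q(Q) - q(t P + (1 - t) Q)] is [t (1 - t) q(P - Q)]. *)
Lemma psd_trace_convex S P Q t : psd S -> 0 <= t <= 1 ->
  \tr ((t *: P + (1 - t) *: Q) *m S *m (t *: P + (1 - t) *: Q)^T) <=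
  t * \tr (P *m S *m P^T) + (1 - t) * \tr (Q *m S *m Q^T).
Proof.
move=> S_ge0 /andP[t_ge0 t_le1].
have := psd_trace_ge0 (P - Q) S_ge0.
rewrite !linearD !linearZ /= !linearN /= !(mulmxDl, mulmxDr).
rewrite !(mulNmx, mulmxN) -!(scalemxAl, scalemxAr) !(mxtraceD, mxtraceZ, raddfN) /=.
set a := \tr (P *m S *m P^T); set b := \tr (P *m S *m Q^T).
set c := \tr (Q *m S *m P^T); set e := \tr (Q *m S *m Q^T) => h.
have : 0 <= t * (1 - t) * (a - b - c + e).
  by apply: mulr_ge0; [rewrite mulr_ge0 ?subr_ge0|lra].
by nra.
Qed.

End quadratic_forms.

(** * Convex functions of scalars and of extended value *)

Lemma powR_convex (R : realType) (p a b t : R) :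
  1 <= p -> 0 <= a -> 0 <= b -> 0 <= t <= 1 ->
  (t * a + (1 - t) * b) `^ p <= t * a `^ p + (1 - t) * b `^ p.
Proof.
move=> p_ge1 a_ge0 b_ge0 /andP[t_ge0 t_le1].
have := convex_powR p_ge1 (Itv01 t_ge0 t_le1).
by move=> /(_ a b); rewrite !inE /= !in_itv /= !andbT; apply.
Qed.

Lemma ln_concave (R : realType) (a b t : R) :
  0 < a -> 0 < b -> 0 <= t <= 1 ->
  t * ln a + (1 - t) * ln b <= ln (t * a + (1 - t) * b).
Proof.
by move=> a_gt0 b_gt0 /andP[t0 t1]; exact: (concave_ln (Itv01 t0 t1)).
Qed.

(** Convexity of [f] on a convex set [D] is all that has to be checked: for
    [0 < t < 1] an end point outside [D] makes the bound infinite. *)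
Lemma convex_ereal_restrict (R : realType) (E : lmodType R) (D : pred E)
    (f : E -> R) :
  (forall x y t, D x -> D y -> 0 <= t <= 1 ->
     D (t *: x + (1 - t) *: y) /\
     f (t *: x + (1 - t) *: y) <= t * f x + (1 - t) * f y) ->
  convex_ereal (fun z => if D z then (f z)%:E else +oo%E).
Proof.
move=> fcvx x y t t01.
have [->|t_neq0] := eqVneq t 0.
  by rewrite subr0 scale0r scale1r add0r mul0e mul1e add0e.
have [->|t_neq1] := eqVneq t 1.
  by rewrite subrr scale0r scale1r addr0 mul0e mul1e adde0.
have /andP[t_ge0 t_le1] := t01.
have t_gt0 : 0 < t by rewrite lt_neqAle eq_sym t_neq0.
have s_gt0 : 0 < 1 - t by rewrite subr_gt0 lt_neqAle t_neq1.
case: (boolP (D x)) => Dx; case: (boolP (D y)) => Dy.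
- have [-> le_f] := fcvx x y t Dx Dy t01.
  by rewrite -!EFinM -EFinD lee_fin.
- by rewrite gt0_muley ?lte_fin// addey ?leey.
- by rewrite gt0_muley ?lte_fin// addye ?leey.
- by rewrite !gt0_muley ?lte_fin// addye ?leey.
Qed.

(** * The energy as a convex function of the minors *)

Section polyconvexity.
Context {R : realType} {d : nat} (gamma theta : R).

(** [z.1.1] stands for the matrix [P], and [z.2] for its determinant, made
    independent of [P]. *)
Definition relaxed_energy (M : 'M[R]_d) (z : minor_space R d) : R :=
  rho M * ((\tr (z.1.1 *m invmx M *m z.1.1^T)) `^ exponent d gamma
    - kappa d gamma theta * (2 * ln z.2 - ln (\det M))).

Lemma W_relaxed_energy (M P : 'M[R]_d) : 0 < \det M ->
  W gamma theta M P =
  (if 0 < \det P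
   then (relaxed_energy M (P, middle_minors P, \det P))%:E else +oo%E).
Proof.
move=> detM; rewrite /W; case: ifPn => // detP.
rewrite /G /relaxed_energy /=; congr (_ * (_ - _ * _))%:E.
rewrite !det_mulmx det_tr det_inv mulrAC -expr2.
by rewrite lnM ?posrE ?invr_gt0 ?exprn_gt0// lnV ?posrE// lnXn// mulr_natl.
Qed.

Lemma exponent_ge1 : (2 <= d)%N -> 1 < gamma -> 1 <= exponent d gamma.
Proof.
move=> hd hgamma; rewrite /exponent.
have : (2%:R : R) <= d%:R by rewrite ler_nat.
by nra.
Qed.

Lemma kappa_ge0 : 0 <= exponent d gamma -> 0 <= kappa d gamma theta.
Proof.
move=> p_ge0; rewrite /kappa; apply: mulr_ge0; last exact: powR_ge0.
by apply: mulr_ge0 => //; exact: powR_ge0.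
Qed.

Lemma W_polyconvex (M : 'M[R]_d) :
  (2 <= d)%N -> 1 < gamma -> spd M -> polyconvex (W gamma theta M).
Proof.
move=> hd hgamma spdM.
have p_ge1 := exponent_ge1 hd hgamma.
have k_ge0 := kappa_ge0 (le_trans ler01 p_ge1).
have S_ge0 := spd_psd_inv spdM.
have detM : 0 < \det M by apply: det_gt0; have [] := spdM.
exists (fun z : minor_space R d =>
  if 0 < z.2 then (relaxed_energy M z)%:E else +oo%E); split.
- by move=> z; case: ifP.
- apply: (@convex_ereal_restrict _ _ (fun z : minor_space R d => 0 < z.2)).
  move=> [[P m] a] [[Q n] b] t /= a_gt0 b_gt0 t01.
  have /andP[t_ge0 t_le1] := t01.
  split.
    have [->|t_neq1] := eqVneq t 1; first by rewrite subrr scale0r scale1r addr0.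
    rewrite ltr_wpDl ?mulr_ge0 ?(ltW a_gt0)// mulr_gt0//.
    by rewrite subr_gt0 lt_neqAle t_neq1.
  rewrite /relaxed_energy /=.
  rewrite mulrCA [X in _ <= _ + X]mulrCA -mulrDr ler_wpM2l ?sqrtr_ge0//.
  have lnc := ln_concave a_gt0 b_gt0 t01.
  have trc : \tr ((t *: P + (1 - t) *: Q) *m invmx M *m
      (t *: P + (1 - t) *: Q)^T) `^ exponent d gamma <=
      t * \tr (P *m invmx M *m P^T) `^ exponent d gamma +
      (1 - t) * \tr (Q *m invmx M *m Q^T) `^ exponent d gamma.
    apply: le_trans (powR_convex p_ge1 (psd_trace_ge0 P S_ge0)
      (psd_trace_ge0 Q S_ge0) t01).
    apply: ge0_ler_powR (psd_trace_convex P Q S_ge0 t01).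
    + exact: le_trans p_ge1.
    + by rewrite nnegrE psd_trace_ge0.
    + by rewrite nnegrE addr_ge0// mulr_ge0 ?subr_ge0// psd_trace_ge0.
  have := ler_wpM2l k_ge0 lnc.
  (* In the last coordinate, scaling in R^o is multiplication in R. *)
  rewrite /GRing.scale /=.
  by lra.
- by move=> P; rewrite W_relaxed_energy.
Qed.

End polyconvexity.

Theorem proposition3p3 (R : realType) (d : nat) (hd : (2 <= d)%N)
    (Omega_p Omega_c : set 'rV[R]_d)
    (Omega_p_polyhedral : polyhedral_domain Omega_p)
    (Omega_p_bounded : bounded_set Omega_p)
    (Omega_c_domain : is_domain Omega_c)
    (Omega_c_measure : (0 < lebesgue_rV R d Omega_c < +oo)%E)
    (M : 'rV[R]_d -> 'M[R]_d)
    (M_measurable : lebesgue_measurable_fun Omega_p M)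
    (M_spd : forall x, Omega_p x -> spd (M x))
    (m0 m1 : R) (m0_gt0 : 0 < m0) (m1_gt0 : 0 < m1)
    (M_bounds : {ae lebesgue_rV R d, forall x, Omega_p x ->
       loewner_le m0%:M (M x) /\ loewner_le (M x) m1%:M})
    (gamma : R) (gamma_gt1 : 1 < gamma) :
  let sigma : R := \int[lebesgue_rV R d]_(x in Omega_p) rho (M x) in
  let theta : R :=
    (sigma / fine (lebesgue_rV R d Omega_c)) `^ (- 2 / d%:R) in
  {ae lebesgue_rV R d, forall x, Omega_p x ->
     polyconvex (W gamma theta (M x))}.
Proof.
move=> sigma theta; apply: aeW => x Omega_x.
exact: (W_polyconvex _ hd gamma_gt1 (M_spd x Omega_x)).
Qed.
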